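(* Let $S$ be a Damek--Ricci space in the half-space model. For a non-zero vector $v\in\mathfrak v$ and parameters $\bar V\in\mathfrak v$, $\bar t\in\mathbb R_+$, $s=\pm\sqrt{1-\|v\|^2}$ (so $\|v\|\le1$), the focal variety $$\mathcal F_{\circledast}^{\eta}=\{(V,Z,t)\in\mathfrak v\oplus\mathfrak z\times\mathbb R_+\mid[V-\bar V,v]=0\text{ and }\langle V-\bar V,v\rangle=2s\sqrt{\bar t}\}$$ is totally geodesic in $S$ if and only if $v$ satisfies the $J^2$-condition.
   Context: Damek--Ricci space: let $\mathfrak s=\mathfrak v\oplus\mathfrak z\oplus\mathfrak a$ be an orthogonal decomposition of a finite-dimensional Euclidean space $(\mathfrak s,\langle\,,\rangle)$ with $\mathfrak a=\mathbb RA$, $\|A\|=1$, $n=\dim\mathfrak v$, $m=\dim\mathfrak z$ (either may be $0$). Let $J$ be a representation on $\mathfrak v$ of the Clifford algebra $\mathrm{Cl}(\mathfrak z,q)$ of $q(Z)=-\langle Z,Z\rangle$ with $\|J_ZV\|=\|Z\|\|V\|$. The Lie bracket on $\mathfrak s$ is determined by $\langle[U,V],Z\rangle=\langle J_ZU,V\rangle$ with $[U,V]\in\mathfrak z$ for $U,V\in\mathfrak v$, $Z\in\mathfrak z$; $[\mathfrak v\oplus\mathfrak z,\mathfrak z]=0$; $[A,V]=\frac12V$ for $V\in\mathfrak v$; $[A,Z]=Z$ for $Z\in\mathfrak z$. The simply connected Lie group $S$ with Lie algebra $\mathfrak s$ and the left-invariant metric induced by $\langle\,,\rangle$ is the Damek--Ricci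 space. Half-space model: $S$ is identified with $\mathfrak v\oplus\mathfrak z\times\mathbb R_+\subset\mathfrak v\oplus\mathfrak z\oplus\mathbb R$ via $(V,Z,t)\mapsto\exp(V+Z)\exp((\ln t)A)$; multiplication is $(V_1,Z_1,t_1)(V_2,Z_2,t_2)=(V_1+\sqrt{t_1}V_2,\ Z_1+t_1Z_2+\frac12\sqrt{t_1}[V_1,V_2],\ t_1t_2)$. The unit speed geodesic from $e=(0,0,1)$ with unit initial velocity $v'+z'+s'A$ is $\hat\gamma(t)=\gamma(\tanh(t/2))$, $\gamma(\theta)=\left(\frac{2\theta(1-s'\theta)}{\chi(\theta)}v'+\frac{2\theta^2}{\chi(\theta)}J_{z'}v',\frac{2\theta}{\chi(\theta)}z',\frac{1-\theta^2}{\chi(\theta)}\right)$, $\chi(\theta)=(1-s'\theta)^2+\|z'\|^2\theta^2$. The set $\mathcal F_{\circledast}^{\eta}$ is the focal variety (zero set) of the isoparametric function $D_{\circledast}^{\eta}(V,Z,t)=\frac1t\left((2s\sqrt{\bar t}-\langle V-\bar V,v\rangle)^2+\|[V-\bar V,v]\|^2\right)$ associated with the left translate $\eta$, by an element $(\bar V,\bar Z,\bar t)\in S$, of the (prolonged) geodesic from $e$ with initial velocity $(v,0,s)$. $J^2$-condition: $v\in\mathfrak v$ satisfies the $J^2$-condition if for any $z_1,z_2\in\mathfrak z$ with $z_1\perp z_2$ there exists $z_3\in\mathfrak z$ with $J_{z_1}J_{z_2}v=J_{z_3}v$. *)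

(* Defs.v *)
From HB Require Import structures.
From mathcomp Require Import all_boot all_order all_algebra.
From mathcomp Require Import all_classical all_reals all_analysis.
Import Order.TTheory GRing.Theory Num.Theory.
Import numFieldNormedType.Exports.

Set Implicit Arguments.
Unset Strict Implicit.
Unset Printing Implicit Defensive.

Local Open Scope classical_set_scope.
Local Open Scope ring_scope.

Section Smoothness.
Variables (R : realType) (V W : normedModType R).

Fixpoint class_C (k : nat) (O : set V) (f : V -> W) : Prop :=
  match k with
  | 0%N => forall x, O x -> {for x, continuous f}
  | k'.+1 => (forall x, O x -> differentiable f x) /\
             (forall v, class_C k' O (fun x => 'D_v f x))
  end.

(* The directional-derivative recursion of class_C gives the usual C^k classes
   because it is only used with finite-dimensional V. *)
Definition smooth_on (O : set V) (f : V -> W) : Prop :=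
  forall k, class_C k O f.

End Smoothness.

(* Riemannian geometry of an open subset U of a finite-dimensional real vector
   space E.  All tangent spaces are identified with E, so a vector field is a
   map E -> E, and a Riemannian metric is a family g p of inner products on E;
   only the values at points of U matter. *)
Section RiemannianGeometry.
Variables (R : realType) (E : normedModType R).

Definition embedded_submanifold (U F : set E) : Prop :=
  F `<=` U /\
  forall p, F p -> exists (k : nat) (O : set E) (f : E -> 'rV[R]_k),
    [/\ open O, O p, O `<=` U, smooth_on O f &
        (forall q, O q -> forall y, exists x, 'd f q x = y) /\
        F `&` O = [set q | O q /\ f q = 0]].

Definition tangent_space (F : set E) (p : E) : set E :=
  [set x | exists (e : R) (c : R^o -> E),
    [/\ 0 < e, smooth_on [set t : R^o | `|t| < e] c,
        (forall t : R^o, `|t| < e -> F (c t)),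
        c 0 = p & 'D_1 c 0 = x]].

(* Every connection on U is nabla_X Y = D_X Y + Gamma(X, Y), with Gamma p
   bilinear; symmetry of Gamma p is torsion-freeness, and the last clause is
   compatibility with the metric, tested on constant fields. *)
Definition levi_civita (U : set E) (g : E -> E -> E -> R)
    (Gamma : E -> E -> E -> E) : Prop :=
  forall p, U p ->
  [/\ (forall y, linear (fun x => Gamma p x y)),
      (forall x, linear (fun y => Gamma p x y)),
      (forall x y, Gamma p x y = Gamma p y x) &
      (forall x y z, is_derive p x (fun q => g q y z : R^o)
                       (g p (Gamma p x y) z + g p y (Gamma p x z)))].

Definition covariant_derivative (Gamma : E -> E -> E -> E)
    (X Y : E -> E) (p : E) : E :=
  'D_(X p) Y p + Gamma p (X p) (Y p).

Definition tangent_field (U F : set E) (X : E -> E) : Prop :=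
  smooth_on U X /\ forall p, F p -> tangent_space F p (X p).

(* F is a submanifold whose second fundamental form vanishes: nabla_X Y is
   tangent to F along F whenever X and Y are. *)
Definition totally_geodesic (U : set E) (g : E -> E -> E -> R) (F : set E)
    : Prop :=
  embedded_submanifold U F /\
  exists Gamma, levi_civita U g Gamma /\
    forall X Y, tangent_field U F X -> tangent_field U F Y ->
    forall p, F p -> tangent_space F p (covariant_derivative Gamma X Y p).

End RiemannianGeometry.

Section DamekRicci.
Variables (R : realType) (n m : nat).

Definition dot k (x y : 'cV[R]_k) : R := \sum_(i < k) x i ord0 * y i ord0.

(* The norm `|x| of the library on 'cV[R]_k is the maximum norm. *)
Definition enorm k (x : 'cV[R]_k) : R := Num.sqrt (dot x x).

(* By the universal property of Cl(z, q), a representation of it on v is a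
   linear map Z |-> J_Z with J_Z J_Z = q(Z) id. *)
Definition clifford_representation (J : {linear 'cV[R]_m -> 'M[R]_n}) : Prop :=
  (forall Z, J Z *m J Z = (- dot Z Z)%:M) /\
  (forall Z V, enorm (J Z *m V) = enorm Z * enorm V).

Variable J : {linear 'cV[R]_m -> 'M[R]_n}.

Definition bracket (U V : 'cV[R]_n) : 'cV[R]_m :=
  \col_k dot (J (delta_mx k ord0) *m U) V.

Lemma bracketP U V Z : dot (bracket U V) Z = dot (J Z *m U) V.
Proof.
have -> : dot (J Z *m U) V = \sum_k Z k ord0 * dot (J (delta_mx k ord0) *m U) V.
  rewrite {1}[Z]matrix_sum_delta linear_sum mulmx_suml /dot.
  under eq_bigr => i _ do rewrite summxE mulr_suml.
  rewrite exchange_big /=; apply: eq_bigr => k _.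
  rewrite mulr_sumr; apply: eq_bigr => i _.
  by rewrite big_ord1 linearZ /= -scalemxAl mxE mulrA.
by apply: eq_bigr => k _; rewrite mxE mulrC.
Qed.

(* v + z + R; both the space containing the half-space and, as its tangent
   space at the identity, the Lie algebra, where (V, Z, r) is V + Z + rA. *)
Definition ambient : normedModType R := ('cV[R]_n * 'cV[R]_m * R^o)%type.

Definition half_space : set ambient := [set p | 0 < p.2].

Definition mulS (p q : ambient) : ambient :=
  (p.1.1 + Num.sqrt p.2 *: q.1.1,
   p.1.2 + p.2 *: q.1.2 + (2^-1 * Num.sqrt p.2) *: bracket p.1.1 q.1.1,
   p.2 * q.2).

Definition invS (p : ambient) : ambient :=
  (- (Num.sqrt p.2)^-1 *: p.1.1, - p.2^-1 *: p.1.2, p.2^-1).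

Definition dotS (x y : ambient) : R :=
  dot x.1.1 y.1.1 + dot x.1.2 y.1.2 + x.2 * y.2.

(* The left-invariant metric equal to dotS at the identity (0, 0, 1):
   g_p(x, y) = <(dL_q)_p x, (dL_q)_p y> with q = p^-1. *)
Definition metric (p x y : ambient) : R :=
  dotS ('d (mulS (invS p)) p x) ('d (mulS (invS p)) p y).

(* Attached to the geodesic from the identity with initial velocity (v, 0, s),
   left translated by (Vb, Zb, tb); the function does not depend on Zb. *)
Definition isoparametric (v Vb : 'cV[R]_n) (tb s : R) (p : ambient) : R :=
  p.2^-1 * ((2 * s * Num.sqrt tb - dot (p.1.1 - Vb) v) ^+ 2
            + enorm (bracket (p.1.1 - Vb) v) ^+ 2).

Definition focal_variety (v Vb : 'cV[R]_n) (tb s : R) : set ambient :=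
  half_space `&` [set p | isoparametric v Vb tb s p = 0].

Definition J2_condition (v : 'cV[R]_n) : Prop :=
  forall z1 z2 : 'cV[R]_m, dot z1 z2 = 0 ->
  exists z3 : 'cV[R]_m, J z1 *m (J z2 *m v) = J z3 *m v.

End DamekRicci.

(* Main.v *)
Require Import Defs.
From HB Require Import structures.
From mathcomp Require Import all_boot all_order all_algebra.
From mathcomp Require Import all_classical all_reals all_analysis.
From mathcomp Require Import ring lra.
Import Order.TTheory GRing.Theory Num.Theory.
Import numFieldNormedType.Exports.

Local Open Scope classical_set_scope.
Local Open Scope ring_scope.

(** The vectors orthogonal to v and to all J_Z v are the horizontal vectors; they
    form a subspace W of the v-part.  The focal variety is the part in the
    half-space of the affine subspace on which V - Vb has prescribed inner
    product with v and bracket with v, so all its tangent spaces are the same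
    subspace W + z + R of the ambient space ([tangent_space_affine_slice]).
    For such a set, being totally geodesic means that the Christoffel map of the
    metric sends pairs of vectors of this subspace into it
    ([totally_geodesic_affine_slice]): differentiating a tangent field in a
    tangent direction never leaves a fixed linear subspace, and constant fields
    test the converse.

    In the half-space coordinates the metric is explicit ([metricE]), and the
    Koszul formula yields its Christoffel map.  The z- and R-components of the
    latter are unconstrained, and its v-component is, up to a factor, a
    combination of the v-components a, b of the two arguments plus
    J_{z'} a + J_z b, where z and z' can be any vectors of the z-part.  Hence the
    focal variety is totally geodesic iff J_Z W is contained in W for every Z.

    Since every J_Z is skew, this says that the orthogonal complement
    R v + J_z v of W is stable under all J_Z.  As J_Z J_Z v is a multiple of v,
    and J_{z1} J_{z2} v is orthogonal to v when z1 and z2 are orthogonal,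
    stability is the J^2-condition ([J2_horizontalP]). *)

(** * The Euclidean inner product *)

Section DotProduct.
Context {R : realType} {k : nat}.
Implicit Types (x y z : 'cV[R]_k) (a : R).

Lemma dotC x y : dot x y = dot y x.
Proof. by apply: eq_bigr => i _; rewrite mulrC. Qed.

Lemma dotDl x y z : dot (x + y) z = dot x z + dot y z.
Proof.
by rewrite /dot -big_split; apply: eq_bigr => i _; rewrite !mxE mulrDl.
Qed.

Lemma dotZl a x y : dot (a *: x) y = a * dot x y.
Proof.
by rewrite /dot mulr_sumr; apply: eq_bigr => i _; rewrite !mxE mulrA.
Qed.

Lemma dotNl x y : dot (- x) y = - dot x y.
Proof. by rewrite -scaleN1r dotZl mulN1r. Qed.

Lemma dotDr x y z : dot z (x + y) = dot z x + dot z y.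
Proof. by rewrite !(dotC z) dotDl. Qed.

Lemma dotZr a x y : dot y (a *: x) = a * dot y x.
Proof. by rewrite !(dotC y) dotZl. Qed.

Lemma dotNr x y : dot y (- x) = - dot y x.
Proof. by rewrite !(dotC y) dotNl. Qed.

Lemma dot0l x : dot 0 x = 0.
Proof. by rewrite -(scale0r 0) dotZl mul0r. Qed.

Lemma dot0r x : dot x 0 = 0.
Proof. by rewrite dotC dot0l. Qed.

Definition dotE :=
  (dotDl, dotDr, dotZl, dotZr, dotNl, dotNr, dot0l, dot0r).

Lemma dot_ge0 x : 0 <= dot x x.
Proof. by apply: sumr_ge0 => i _; rewrite -expr2 sqr_ge0. Qed.

Lemma dot_eq0 x : (dot x x == 0) = (x == 0).
Proof.
apply/eqP/eqP => [h|->]; last exact: dot0l.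
apply/colP => i; rewrite mxE; apply/eqP.
have /psumr_eq0P h' : forall i : 'I_k, true -> 0 <= x i ord0 * x i ord0.
  by move=> j _; rewrite -expr2 sqr_ge0.
by have := h' h i isT; move/eqP; rewrite mulf_eq0 orbb.
Qed.

Lemma dot_inj x y : (forall z, dot x z = dot y z) -> x = y.
Proof.
move=> h; apply/eqP; rewrite -subr_eq0 -dot_eq0 dotDl dotNl h.
by rewrite subrr.
Qed.

Lemma enorm_sqr x : enorm x ^+ 2 = dot x x.
Proof. by rewrite sqr_sqrtr // dot_ge0. Qed.

End DotProduct.

(** * Clifford representations and horizontal vectors *)

(** The orthogonal complement of R v + J_z v, because
    <[U, v], Z> = - <U, J_Z v>. *)
Definition horizontal {R : realType} {n m : nat}
    (J : {linear 'cV[R]_m -> 'M[R]_n}) (v U : 'cV[R]_n) : Prop :=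
  dot U v = 0 /\ bracket J U v = 0.

Section Clifford.
Context {R : realType} {n m : nat} {J : {linear 'cV[R]_m -> 'M[R]_n}}.
Implicit Types (U V v : 'cV[R]_n) (Z : 'cV[R]_m).

Lemma bracketDl U U' V : bracket J (U + U') V = bracket J U V + bracket J U' V.
Proof.
by apply: dot_inj => Z; rewrite dotDl !bracketP mulmxDr dotDl.
Qed.

Lemma bracketZl a U V : bracket J (a *: U) V = a *: bracket J U V.
Proof.
by apply: dot_inj => Z; rewrite dotZl !bracketP -scalemxAr dotZl.
Qed.

Lemma bracketDr U V V' : bracket J U (V + V') = bracket J U V + bracket J U V'.
Proof. by apply: dot_inj => Z; rewrite dotDl !bracketP dotDr. Qed.

Lemma bracketZr a U V : bracket J U (a *: V) = a *: bracket J U V.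
Proof. by apply: dot_inj => Z; rewrite dotZl !bracketP dotZr. Qed.

Lemma bracket0l V : bracket J 0 V = 0.
Proof. by rewrite -(scale0r 0) bracketZl scale0r. Qed.

Lemma bracket0r U : bracket J U 0 = 0.
Proof. by rewrite -(scale0r 0) bracketZr scale0r. Qed.

Lemma bracketNl U V : bracket J (- U) V = - bracket J U V.
Proof. by rewrite -scaleN1r bracketZl scaleN1r. Qed.

Hypothesis hJ : clifford_representation J.

Lemma dotJJ Z V : dot (J Z *m V) (J Z *m V) = dot Z Z * dot V V.
Proof. by rewrite -!enorm_sqr hJ.2 exprMn. Qed.

(** Polarization of [dotJJ] in the vector; [dotJ] below polarizes it in Z. *)
Lemma J_conformal Z U V : dot (J Z *m U) (J Z *m V) = dot Z Z * dot U V.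
Proof.
have := dotJJ Z (U + V); rewrite mulmxDr !dotE !dotJJ.
rewrite (dotC V U) (dotC (J Z *m V)) => h; lra.
Qed.

Lemma dotJ Z Z' V : dot (J Z *m V) (J Z' *m V) = dot Z Z' * dot V V.
Proof.
have := dotJJ (Z + Z') V; rewrite linearD mulmxDl !dotE !dotJJ.
rewrite (dotC Z' Z) (dotC (J Z' *m V)) => h; lra.
Qed.

Lemma mulJJ Z V : J Z *m (J Z *m V) = - dot Z Z *: V.
Proof. by rewrite mulmxA hJ.1 mul_scalar_mx. Qed.

(** A similarity whose square is - |Z|^2 is skew: replace V by J_Z V in
    [J_conformal] and divide by |Z|^2. *)
Lemma J_skew Z U V : dot (J Z *m U) V = - dot U (J Z *m V).
Proof.
have [->|Z0] := eqVneq Z 0; first by rewrite linear0 !mul0mx !dotE oppr0.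
have zz : dot Z Z != 0 by rewrite dot_eq0.
apply: (mulfI zz); have := J_conformal Z U (J Z *m V).
rewrite mulJJ dotZr => h; lra.
Qed.

(** For non-zero v, this makes Z |-> - |v|^-2 J_Z v a right inverse of the bracket
    with v, which is therefore onto the z-part. *)
Lemma bracket_J Z v : bracket J (J Z *m v) v = - dot v v *: Z.
Proof.
apply: dot_inj => Z'; rewrite bracketP J_skew dotJ dotZl; ring.
Qed.

Lemma bracket_self v : bracket J v v = 0.
Proof.
apply: dot_inj => Z; rewrite dot0l bracketP.
have := J_skew Z v v; rewrite (dotC v) => h; lra.
Qed.

Lemma horizontalD v U U' :
  horizontal J v U -> horizontal J v U' -> horizontal J v (U + U').
Proof.
move=> [d b] [d' b'].
by split; rewrite ?dotDl ?bracketDl ?d ?d' ?b ?b' addr0.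
Qed.

Lemma horizontalZ a v U : horizontal J v U -> horizontal J v (a *: U).
Proof.
by move=> [d b]; split; rewrite ?dotZl ?bracketZl ?d ?b ?mulr0 ?scaler0.
Qed.

(** By skewness, W = [horizontal J v] is J-stable iff its complement
    R v + J_z v is.  For the direct implication, the test vector Z' is split
    along Z and its complement: on the second part the J^2-condition applies,
    and J_Z J_Z v is a multiple of v.  Conversely, the difference u of
    J_{z1} J_{z2} v and its projection to J_z v is horizontal, and stability of
    W makes it orthogonal to both terms. *)
Lemma J2_horizontalP v : v != 0 ->
  J2_condition J v <-> forall Z U, horizontal J v U -> horizontal J v (J Z *m U).
Proof.
move=> v0; split=> [J2 Z U [Uv UJv]|inv z1 z2 z12].
  have dUJ Z' : dot U (J Z' *m v) = 0.
    by apply: oppr_inj; rewrite -J_skew -bracketP UJv dot0l oppr0.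
  split; first by rewrite J_skew dUJ oppr0.
  apply: dot_inj => Z'; rewrite dot0l bracketP J_skew J_skew opprK.
  have [Z0|Z0] := eqVneq (dot Z Z) 0.
    by move/eqP: Z0; rewrite dot_eq0 => /eqP ->; rewrite linear0 mul0mx dot0r.
  set c := dot Z' Z / dot Z Z.
  have [|Z3 eZ3] := J2 Z (Z' - c *: Z).
    by rewrite !dotE (dotC Z Z') /c; field.
  have -> : J Z' = J (Z' - c *: Z) + c *: J Z by rewrite -linearZ -linearD subrK.
  rewrite mulmxDl -scalemxAl mulmxDr -scalemxAr eZ3 mulJJ.
  by rewrite !dotE dUJ Uv !mulr0 addr0.
have vv : dot v v != 0 by rewrite dot_eq0.
set w := J z1 *m (J z2 *m v).
(* J_{z3} v is the projection of w to the space of all J_Z v. *)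
pose z3 := - (dot v v)^-1 *: bracket J w v.
pose u := w - J z3 *m v.
have uJv : bracket J u v = 0.
  rewrite /u bracketDl bracketNl bracket_J /z3 scalerA mulrNN.
  by rewrite divff // scale1r subrr.
have hu : horizontal J v u.
  split=> //; rewrite /u !dotE /w J_skew dotJ (dotC z2) z12.
  have := J_skew z3 v v; rewrite (dotC v) => h; lra.
exists z3; apply/eqP; rewrite -subr_eq0 -/u -dot_eq0 {1}/u dotDl dotNl.
rewrite /w J_skew J_skew opprK (dotC v) (inv z2 _ (inv z1 _ hu)).1.
by rewrite J_skew (dotC v) (inv z3 _ hu).1 !oppr0 addr0.
Qed.

End Clifford.

(** * Affine maps and their derivatives *)

Section AffineMaps.
Context {R : realType} {V W : normedModType R}.

Lemma smooth_cst (O : set V) (w : W) : smooth_on O (cst w).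
Proof.
move=> k; elim: k w => [|k IHk] w /=; first by move=> x _; exact: cst_continuous.
split=> [x _|v]; first exact: differentiable_cst.
rewrite (_ : 'D_v (cst w) = cst 0); first exact: IHk.
by apply/funext => x; rewrite derive_cst.
Qed.

Context {L : V -> W} (linL : linear L) (contL : continuous L) (w : W).

Lemma affine_diff x :
  differentiable (fun q => L q + w) x /\
  'd (fun q => L q + w) x = L :> (V -> W).
Proof.
pose Ll : {linear V -> W} := HB.pack L (GRing.isLinear.Build _ _ _ _ L linL).
have dL : is_diff x ((L : V -> W) + cst w) ((L : V -> W) + 0).
  apply: is_diffD.
  apply: DiffDef; first exact: (@linear_differentiable _ _ _ Ll).
  exact: (@diff_lin _ _ _ Ll).
split; first exact: (@ex_diff _ _ _ _ _ _ _ dL).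
by rewrite (@diff_val _ _ _ _ _ _ _ dL) addr0.
Qed.

Lemma is_derive_affine x v : is_derive x v (fun q => L q + w) (L v).
Proof.
have [d e] := affine_diff x.
by apply: DeriveDef; [exact: diff_derivable|rewrite deriveE // e].
Qed.

Lemma smooth_affine (O : set V) : smooth_on O (fun q => L q + w).
Proof.
case=> [|k] /=.
  by move=> x _; apply: differentiable_continuous; have [] := affine_diff x.
split=> [x _|v]; first by have [] := affine_diff x.
rewrite (_ : 'D_v _ = cst (L v)); first exact: smooth_cst.
by apply/funext => x; have [_ ->] := is_derive_affine x v.
Qed.

(** Directional derivatives commute with continuous linear maps; in particular
    a map with values in an affine subspace has derivatives in its direction. *)
Lemma linear_derive_eq0 (E : normedModType R) (F : E -> V) p x :
  derivable F p x ->
  (\forall h \near (0 : R), L (F (h *: x + p)) = L (F p)) ->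
  L ('D_x F p) = 0.
Proof.
pose Ll : {linear V -> W} := HB.pack L (GRing.isLinear.Build _ _ _ _ L linL).
move=> dF hF.
have LE y : L y = Ll y by [].
have cF : L (h^-1 *: (F (h *: x + p) - F p)) @[h --> (0 : R)^'] --> L ('D_x F p).
  exact: (cvg_comp _ _ dF (contL _)).
apply: (cvg_unique _ cF) => //; apply: cvg_near_cst.
apply: cvg_within; near=> h.
rewrite LE linearZ linearB /=; have -> : L (F (h *: x + p)) = L (F p).
  by near: h.
by rewrite subrr scaler0.
Unshelve. all: by end_near. Qed.

End AffineMaps.

Lemma is_derive_dot {R : realType} {E : normedModType R} {k : nat}
    (f g : E -> 'cV[R]_k) (df dg : 'cV[R]_k) (p x : E) :
  (forall i, is_derive p x (fun q => f q i ord0 : R^o) (df i ord0)) ->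
  (forall i, is_derive p x (fun q => g q i ord0 : R^o) (dg i ord0)) ->
  is_derive p x (fun q => dot (f q) (g q) : R^o) (dot df (g p) + dot (f p) dg).
Proof.
move=> hf hg.
rewrite (_ : (fun q => _) =
    \sum_(i < k) ((fun q => f q i ord0 : R^o) * (fun q => g q i ord0 : R^o))).
  apply: is_derive_eq; rewrite /dot -big_split; apply: eq_bigr => i _.
  by rewrite /GRing.scale /=; ring.
by apply/funext => q; rewrite fct_sumE.
Qed.

(** * Affine slices of open sets and their second fundamental form *)

Section AffineSubmanifold.
Context {R : realType} {E : normedModType R} {U : set E}.
Hypothesis openU : open U.

Lemma near_line p x : U p -> \forall h \near (0 : R), U (h *: x + p).
Proof.
move=> Up; have cl : continuous (fun h : R => h *: x + p).
  move=> h; apply: cvgD; last exact: cvg_cst.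
  exact: scalel_continuous.
apply: (cl 0); apply: open_nbhs_nbhs; split=> //=.
by rewrite scale0r add0r.
Qed.

Context {k : nat} {K : E -> 'rV[R]_k} (linK : linear K) (contK : continuous K).
Variable c : 'rV[R]_k.

Definition affine_slice : set E := [set p | U p /\ K p = c].

Lemma affine_slice_submanifold :
  (forall y, exists x, K x = y) -> embedded_submanifold U affine_slice.
Proof.
move=> surjK; split=> [p []//|p [Up Kp]].
exists k, U, (fun q => K q - c); split=> //; first exact: smooth_affine.
split=> [q _ y|].
  by have [x <-] := surjK y; exists x; rewrite (affine_diff linK contK _ q).2.
apply/seteqP; split=> q /=; rewrite /affine_slice /=.
  by move=> [[Uq ->] _]; rewrite subrr.
by move=> [Uq /eqP]; rewrite subr_eq0 => /eqP.
Qed.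

(** One inclusion differentiates the equation of the slice along a curve, the
    other uses straight lines, which stay in U for short times. *)
Lemma tangent_space_affine_slice p x : affine_slice p ->
  tangent_space affine_slice p x <-> K x = 0.
Proof.
move=> [Up Kp]; split=> [[e [g [e0 sg gF g0 <-]]]|Kx].
  apply: (linear_derive_eq0 linK contK).
    by apply: diff_derivable; apply: (sg 1%N).1 => /=; rewrite normr0.
  rewrite g0 Kp; apply/nbhs_ballP; exists e => // h /=.
  rewrite /ball /= sub0r normrN => he.
  by apply: (gF _ _).2; rewrite addr0 /GRing.scale /= mulr1.
have /nbhs_ballP[e /= e0 he] := near_line p x Up.
have lin : linear (fun t : R^o => t *: x).
  by move=> a t t'; rewrite scalerDl -scalerA.
have cont : continuous (fun t : R^o => t *: x) by exact: scalel_continuous.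
exists e, (fun t => t *: x + p); split=> //.
- exact: smooth_affine.
- move=> t te; split; last by rewrite linK Kx scaler0 add0r.
  by apply: he; rewrite /ball /= sub0r normrN.
- by rewrite scale0r add0r.
- by have [_ ->] := is_derive_affine lin cont p 0 1; rewrite scale1r.
Qed.

Section LeviCivita.
Context {g : E -> E -> E -> R}.
Hypothesis g_linear : forall p y, U p -> linear (fun x => g p x y : R^o).
Hypothesis g_sym : forall p x y, U p -> g p x y = g p y x.
Hypothesis g_definite : forall p x, U p -> g p x x = 0 -> x = 0.

(** The difference D of two Levi-Civita connections is symmetric, and
    g (D x y) z is skew in y and z; three skew swaps, separated by symmetric
    ones, lead back to the form with the opposite sign. *)
Lemma levi_civita_unique G G' p x y : U p ->
  levi_civita U g G -> levi_civita U g G' -> G p x y = G' p x y.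
Proof.
move=> Up /(_ p Up)[_ _ symG metG] /(_ p Up)[_ _ symG' metG'].
have gB a b z : g p (a - b) z = g p a z - g p b z.
  rewrite addrC -scaleN1r g_linear //.
  by rewrite /GRing.scale /= mulN1r addrC.
pose D a b := G p a b - G' p a b.
have symD a b : D a b = D b a by rewrite /D symG symG'.
have skewD a b z : g p (D a b) z = - g p b (D a z).
  have [_ e] := metG a b z; have [_ e'] := metG' a b z.
  move: e; rewrite e' /D gB (g_sym p b (_ - _)) // gB.
  rewrite (g_sym p (G p a z) b) // (g_sym p (G' p a z) b) // => e; lra.
apply/eqP; rewrite -subr_eq0 -/(D x y); apply/eqP/(g_definite _ _ Up).
have alternating z : g p (D x y) z = - g p (D x y) z.
  rewrite {1}skewD g_sym // symD skewD opprK g_sym // symD skewD.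
  by rewrite g_sym // symD.
by have := alternating (D x y) => h; lra.
Qed.

(** The tangent spaces all equal the kernel of K.  Hence the derivative part of
    a covariant derivative of tangent fields is tangent in any case, and only
    the Christoffel part matters; vectors of the kernel extend to constant
    tangent fields, so that no pair of vectors escapes the test. *)
Lemma totally_geodesic_affine_slice G :
  levi_civita U g G -> (forall y, exists x, K x = y) ->
  totally_geodesic U g affine_slice <->
  (forall p, affine_slice p -> forall x y, K x = 0 -> K y = 0 ->
     K (G p x y) = 0).
Proof.
move=> lcG surjK; split=> [[_ [G' [lcG' tgG']]] p Fp x y Kx Ky|KG].
  have tangent_cst z : K z = 0 -> tangent_field U affine_slice (cst z).
    by split=> [|q Fq]; [exact: smooth_cst|apply/tangent_space_affine_slice].
  have := tgG' _ _ (tangent_cst _ Kx) (tangent_cst _ Ky) p Fp.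
  move/(tangent_space_affine_slice _ _ Fp).
  rewrite /covariant_derivative derive_cst add0r /=.
  by rewrite (levi_civita_unique _ _ _ _ _ Fp.1 lcG lcG').
split; first exact: affine_slice_submanifold.
exists G; split=> // X Y [_ tX] [sY tY] p Fp.
have KX := (tangent_space_affine_slice _ _ Fp).1 (tX p Fp).
apply/(tangent_space_affine_slice _ _ Fp); rewrite /covariant_derivative.
rewrite -['D_(X p) Y p]scale1r linK scale1r KG // ?addr0; last first.
  by apply/(tangent_space_affine_slice _ _ Fp); exact: tY.
have KY q : affine_slice q -> K (Y q) = 0.
  by move=> Fq; apply/(tangent_space_affine_slice _ _ Fq); exact: tY.
apply: (linear_derive_eq0 linK contK).
  by apply: diff_derivable; apply: (sY 1%N).1; exact: Fp.1.
have := near_line p (X p) Fp.1; apply: filterS => h Uh.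
rewrite !KY //; split=> //.
by rewrite linK KX scaler0 add0r Fp.2.
Qed.

End LeviCivita.

End AffineSubmanifold.

(** * The half-space model *)

(** Up to the factor p.2^-1, the z-component of the vector x at p after left
    translation to the identity. *)
Definition central {R : realType} {n m : nat}
    (J : {linear 'cV[R]_m -> 'M[R]_n}) (p x : ambient R n m) : 'cV[R]_m :=
  x.1.2 - 2^-1 *: bracket J p.1.1 x.1.1.

(** Solves the Koszul formula for constant fields.  The middle component is
    written so that [central] takes a simple value on the result. *)
Definition christoffel {R : realType} {n m : nat}
    (J : {linear 'cV[R]_m -> 'M[R]_n}) (p x y : ambient R n m) :
    ambient R n m :=
  let V := - (2^-1 * p.2^-1) *: (x.2 *: y.1.1 + y.2 *: x.1.1
             + J (central J p y) *m x.1.1 + J (central J p x) *m y.1.1) in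
  (V,
   - p.2^-1 *: (x.2 *: central J p y + y.2 *: central J p x)
     + 2^-1 *: bracket J p.1.1 V,
   2^-1 * dot x.1.1 y.1.1 + p.2^-1 * dot (central J p x) (central J p y)
     - p.2^-1 * (x.2 * y.2)).

(** The derivative of g(y, z) at p in the direction x. *)
Definition metric_derivative {R : realType} {n m : nat}
    (J : {linear 'cV[R]_m -> 'M[R]_n}) (p x y z : ambient R n m) : R :=
  - p.2^-1 ^+ 2 * x.2 * dot y.1.1 z.1.1
  - 2 * p.2^-1 ^+ 3 * x.2 * (dot (central J p y) (central J p z) + y.2 * z.2)
  - 2^-1 * p.2^-1 ^+ 2 * (dot (bracket J x.1.1 y.1.1) (central J p z)
                          + dot (central J p y) (bracket J x.1.1 z.1.1)).

(** The two linear conditions of the focal variety as one map, as required of a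
    local defining function of a submanifold. *)
Definition constraint {R : realType} {n m : nat}
    (J : {linear 'cV[R]_m -> 'M[R]_n}) (v : 'cV[R]_n) (p : ambient R n m) :
    'rV[R]_(1 + m) :=
  row_mx (dot p.1.1 v)%:M (bracket J p.1.1 v)^T.

Section Model.
Context {R : realType} {n m : nat}.
Notation S := (ambient R n m).

Lemma linear_col_continuous {k} {W : normedModType R} (f : 'cV[R]_k -> W) :
  linear f -> continuous f.
Proof.
move=> linf.
pose fl : {linear 'cV[R]_k -> W} := HB.pack f (GRing.isLinear.Build _ _ _ _ f linf).
have -> : f = fun x => \sum_(i < k) x i ord0 *: f (delta_mx i ord0).
  apply/funext => x; rewrite {1}[x]matrix_sum_delta -[f _]/(fl _) linear_sum.
  by apply: eq_bigr => i _; rewrite big_ord1 linearZ.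
apply: continuous_big => [|i _ x]; first exact: add_continuous.
apply: (cvg_comp (fun M : 'cV[R]_k => M i ord0)
                 (fun r : R => r *: f (delta_mx i ord0))).
  exact: coord_continuous.
exact: scalel_continuous.
Qed.

Lemma ambient_linear_continuous {W : normedModType R} (f : S -> W) :
  linear f -> continuous f.
Proof.
move=> linf.
pose fl : {linear S -> W} := HB.pack f (GRing.isLinear.Build _ _ _ _ f linf).
have linV : linear (fun V => f ((V, 0, 0) : S)).
  move=> a V V'; rewrite -linf; congr f; congr (_, _, _); rewrite /=;
  by rewrite ?scaler0 ?addr0.
have linZ : linear (fun Z => f ((0, Z, 0) : S)).
  move=> a V V'; rewrite -linf; congr f; congr (_, _, _); rewrite /=;
  by rewrite ?scaler0 ?addr0.
have -> : f = fun p => f (p.1.1, 0, 0) + f (0, p.1.2, 0) + p.2 *: f (0, 0, 1).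
  apply/funext => -[[V Z] t] /=; rewrite -[f (0, 0, 1)]/(fl _).
  rewrite -linearZ /= -[f _ + _]/(fl _ + fl _) -linearD -[fl _ + _]linearD.
  congr f; congr (_, _, _); rewrite /= ?addr0 ?add0r ?scaler0 ?addr0 //.
  by rewrite /GRing.scale /= mulr1.
move=> p; apply: cvgD; [apply: cvgD|].
- apply: (cvg_comp (fun q : S => q.1.1) (fun V => f (V, 0, 0) : W)).
    by apply: cvg_comp; exact: cvg_fst.
  exact: (linear_col_continuous _ linV).
- apply: (cvg_comp (fun q : S => q.1.2) (fun V => f (0, V, 0) : W)).
    by apply: cvg_comp; [exact: cvg_fst|exact: cvg_snd].
  exact: (linear_col_continuous _ linZ).
- apply: (cvg_comp (fun q : S => q.2) (fun r : R => r *: f (0, 0, 1))).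
    exact: cvg_snd.
  exact: scalel_continuous.
Qed.

Lemma half_space_open : open (@half_space R n m).
Proof.
rewrite (_ : @half_space R n m = (fun p : S => p.2) @^-1` [set t : R | 0 < t]) //.
apply: open_comp; last exact: open_gt.
by move=> p _; exact: cvg_snd.
Qed.

Context {J : {linear 'cV[R]_m -> 'M[R]_n}}.

(** Left translations are affine in these coordinates. *)
Lemma diff_mulS p q x :
  'd (mulS J p) q x =
  (Num.sqrt p.2 *: x.1.1,
   p.2 *: x.1.2 + (2^-1 * Num.sqrt p.2) *: bracket J p.1.1 x.1.1,
   p.2 * x.2) :> S.
Proof.
pose L (x : S) : S := (Num.sqrt p.2 *: x.1.1,
   p.2 *: x.1.2 + (2^-1 * Num.sqrt p.2) *: bracket J p.1.1 x.1.1,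
   p.2 * x.2).
have linL : linear L.
  move=> a y z; congr (_, _, _) => /=.
  - by rewrite scalerDr !scalerA mulrC.
  - rewrite bracketDr bracketZr !scalerDr !scalerA !(mulrC a) -!addrA.
    by congr (_ + _); rewrite addrCA.
  - by rewrite mulrDr /GRing.scale /= mulrCA.
have contL : continuous L by exact: ambient_linear_continuous.
rewrite (_ : mulS J p = fun q => L q + ((p.1.1, p.1.2, 0) : S)).
  by rewrite (affine_diff linL contL _ q).2.
apply/funext => y; congr (_, _, _); rewrite /= ?addr0 //; first exact: addrC.
by rewrite [RHS]addrC addrA.
Qed.

(** Left translation by the inverse of p divides the v-part by the square root of
    the height of p, and the rest by the height. *)
Lemma metricE p x y : @half_space R n m p ->
  metric J p x y = p.2^-1 * dot x.1.1 y.1.1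
    + p.2^-1 ^+ 2 * (dot (central J p x) (central J p y) + x.2 * y.2).
Proof.
move=> p0; rewrite /metric !diff_mulS /dotS /=.
have rr : Num.sqrt p.2^-1 ^+ 2 = p.2^-1.
  by rewrite sqr_sqrtr // invr_ge0 ltW.
have cE z : p.2^-1 *: z.1.2 + (2^-1 * Num.sqrt p.2^-1) *:
    bracket J (- (Num.sqrt p.2)^-1 *: p.1.1) z.1.1 = p.2^-1 *: central J p z.
  rewrite /central scalerBr bracketZl !scalerA; congr (_ + _).
  rewrite -scaleNr; congr (_ *: _).
  by rewrite -sqrtrV ?ltW // mulrN -mulrA -expr2 rr mulrC.
rewrite !cE !dotE (mulrA (Num.sqrt _)) -[_ * Num.sqrt _]expr2 rr; ring.
Qed.

Lemma metric_symmetric p x y : @half_space R n m p ->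
  metric J p x y = metric J p y x.
Proof.
by move=> p0; rewrite !metricE // dotC (dotC (central J p x)) (mulrC x.2).
Qed.

Lemma central_linear p : linear (central J p).
Proof.
move=> a x y; rewrite /central /= bracketDr bracketZr scalerBr scalerDr.
by rewrite !scalerA (mulrC _ a) opprD addrACA.
Qed.

Lemma metric_linear p y : @half_space R n m p ->
  linear (fun x => metric J p x y : R^o).
Proof.
move=> p0 a x z; rewrite !metricE // (central_linear p a) /= !dotE.
rewrite /GRing.scale /= /GRing.scale /=; ring.
Qed.

Lemma metric_definite p x : @half_space R n m p -> metric J p x x = 0 -> x = 0.
Proof.
move=> p0; rewrite metricE // -expr2.
have i0 : 0 < p.2^-1 by rewrite invr_gt0.
have := dot_ge0 x.1.1; have := dot_ge0 (central J p x); have := sqr_ge0 x.2.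
move=> h1 h2 h3 e.
have e' : [/\ x.1.1 = 0, central J p x = 0 & x.2 = 0].
  move/eqP: e; rewrite paddr_eq0 ?mulr_ge0 ?addr_ge0 ?(ltW i0) //.
  rewrite !mulf_eq0 (gt_eqF i0) /= paddr_eq0 // !dot_eq0 sqrf_eq0.
  by case/and3P => /eqP ? /eqP ? /eqP.
case: e'; case: x {e h1 h2 h3} => [[V Z] t] /= -> /[swap] ->.
by rewrite /central /= bracket0r scaler0 subr0 => ->.
Qed.

Lemma central_christoffel p x y :
  central J p (christoffel J p x y) =
  - p.2^-1 *: (x.2 *: central J p y + y.2 *: central J p x).
Proof. by rewrite /central /= addrK. Qed.

(** The components in the left-invariant frame determine a vector. *)
Lemma eq_ambient p x y :
  x.1.1 = y.1.1 -> central J p x = central J p y -> x.2 = y.2 -> x = y.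
Proof.
case: x y => [[V Z] t] [[V' Z'] t'] /= <- + <-.
by rewrite /central /= => /addIr ->.
Qed.

Lemma christoffel_sym p x y : christoffel J p x y = christoffel J p y x.
Proof.
apply: (eq_ambient p).
- by rewrite /= (addrC (x.2 *: _)) addrAC.
- by rewrite !central_christoffel (addrC (x.2 *: _)).
- by rewrite /= dotC (dotC (central J p x)) (mulrC x.2).
Qed.

Lemma christoffel_linear p y : linear (fun x => christoffel J p x y).
Proof.
move=> a x z; apply: (eq_ambient p).
- have /= eJ : J (central J p (a *: x + z)) =
      a *: J (central J p x) + J (central J p z).
    by rewrite central_linear linearD linearZ.
  rewrite /= eJ !mulmxDl !mulmxDr -!scalemxAl -!scalemxAr.
  by apply: dot_inj => w; rewrite !dotE /GRing.scale /=; ring.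
- rewrite (central_linear p a) !central_christoffel (central_linear p a) /=.
  by apply: dot_inj => w; rewrite !dotE /GRing.scale /=; ring.
- rewrite /= (central_linear p a) !dotE /GRing.scale /= /GRing.scale /=; ring.
Qed.

Hypothesis hJ : clifford_representation J.

(** The terms with [J (central J p x)] cancel because J is skew, the others
    cancel in pairs. *)
Lemma christoffel_compatible p x y z : @half_space R n m p ->
  metric J p (christoffel J p x y) z + metric J p y (christoffel J p x z) =
  metric_derivative J p x y z.
Proof.
move=> p0; have pN0 : p.2 != 0 by rewrite gt_eqF.
rewrite /metric_derivative (metricE p (christoffel J p x y)) // (metricE p y) //.
rewrite !central_christoffel /=.
move: (central J p x) (central J p y) (central J p z) => cx cy cz; rewrite !dotE.
rewrite (dotC cy (bracket _ _ _)) !bracketP (dotC y.1.1 (J cz *m _)).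
rewrite (dotC y.1.1 (J _ *m z.1.1)) (J_skew hJ cx z.1.1) (dotC z.1.1 (J _ *m _)).
rewrite (dotC y.1.1 x.1.1) (dotC cy cx).
by field.
Qed.

Lemma is_derive_central_coord (p x y : S) i :
  is_derive p x (fun q => central J q y i ord0 : R^o)
    ((- 2^-1 *: bracket J x.1.1 y.1.1) i ord0).
Proof.
pose L (q : S) : R^o := (- 2^-1 *: bracket J q.1.1 y.1.1) i ord0.
have linL : linear L.
  by move=> a q r; rewrite /L /= bracketDl bracketZl !mxE /GRing.scale /=; ring.
rewrite (_ : (fun q => _) = fun q => L q + (y.1.2 i ord0 : R^o)).
  exact: is_derive_affine (ambient_linear_continuous _ linL) _ _ _.
by apply/funext => q; rewrite /L /central !mxE; ring.
Qed.

Lemma is_derive_inv_height (p x : S) : p.2 != 0 ->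
  is_derive p x (fun q : S => q.2^-1 : R^o) (- p.2^-1 ^+ 2 * x.2).
Proof.
move=> p0; have linL : linear (fun q : S => q.2) by [].
have [d e] := is_derive_affine linL (ambient_linear_continuous _ linL) 0 p x.
have fE : (fun q : S => q.2 + 0 : R^o) = snd by apply/funext => q; rewrite addr0.
rewrite fE in d e; apply: DeriveDef; first exact: derivableV.
by rewrite deriveV // e exprVn.
Qed.

Lemma is_derive_metric p x y z : @half_space R n m p ->
  is_derive p x (fun q => metric J q y z : R^o)
  (metric_derivative J p x y z).
Proof.
move=> p0; have pN0 : p.2 != 0 by rewrite gt_eqF.
pose f q := (q.2^-1 : R^o) * dot y.1.1 z.1.1
  + q.2^-1 ^+ 2 * (dot (central J q y) (central J q z) + y.2 * z.2).
apply: (@near_eq_is_derive _ _ _ f).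
  have : \forall q \near p, half_space q.
    by apply: open_nbhs_nbhs; split; [exact: half_space_open|].
  by apply: filterS => q q0; rewrite metricE.
have di := is_derive_inv_height p x pN0.
have dd := is_derive_dot _ _ _ _ p x (is_derive_central_coord p x y)
   (is_derive_central_coord p x z).
pose i (q : S) : R^o := q.2^-1.
pose c (q : S) : R^o := dot (central J q y) (central J q z).
rewrite -/i in di; rewrite -/c in dd.
rewrite (_ : f = i * cst (dot y.1.1 z.1.1) + i ^+ 2 * (c + cst (y.2 * z.2))) //.
apply: is_derive_eq.
rewrite /metric_derivative /GRing.scale /= !fctE /c /i.
move: (central J p y) (central J p z) => cy cz; rewrite !dotE; ring.
Qed.

Lemma levi_civita_christoffel :
  levi_civita (@half_space R n m) (metric J) (christoffel J).
Proof.
move=> p p0; split=> [y|x|x y|x y z].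
- exact: christoffel_linear.
- by move=> a y z; rewrite !(christoffel_sym _ x) christoffel_linear.
- exact: christoffel_sym.
- by rewrite christoffel_compatible //; exact: is_derive_metric.
Qed.

Lemma constraint_linear v : linear (constraint J v).
Proof.
move=> a x y; rewrite /constraint /= !dotE bracketDl bracketZl.
rewrite scale_row_mx add_row_mx; congr row_mx.
  by rewrite scale_scalar_mx -raddfD.
by rewrite linearD linearZ.
Qed.

Lemma constraint_eqP v (p : S) r :
  constraint J v p = row_mx r%:M 0 <-> dot p.1.1 v = r /\ bracket J p.1.1 v = 0.
Proof.
split=> [/eq_row_mx[+ /(canRL trmxK)]|[<- e]]; last by rewrite /constraint e trmx0.
by rewrite trmx0 => /matrixP/(_ ord0 ord0); rewrite !mxE !mulr1n.
Qed.

Lemma constraint_eq0P v (p : S) : constraint J v p = 0 <-> horizontal J v p.1.1.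
Proof. by rewrite -row_mx0 -(raddf0 scalar_mx) constraint_eqP. Qed.

(** The vectors v and J_z v are independent: v spans the kernel of the bracket
    with v on R v + J_z v, and [bracket_J] solves for the central part. *)
Lemma constraint_surjective v : v != 0 ->
  forall y, exists x : S, constraint J v x = y.
Proof.
move=> v0 y; have vv : dot v v != 0 by rewrite dot_eq0.
pose z : 'cV[R]_m := - (dot v v)^-1 *: (rsubmx y)^T.
pose r := (dot v v)^-1 * lsubmx y ord0 ord0.
exists (r *: v + J z *m v, 0, 0).
rewrite -[y]hsubmxK; congr row_mx.
- rewrite [lsubmx y]mx11_scalar /= !dotE.
  have := J_skew hJ z v v; rewrite (dotC v) => h.
  have -> : dot (J z *m v) v = 0 by lra.
  by rewrite addr0 /r mulrAC mulVf // mul1r.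
- rewrite /= bracketDl bracketZl (bracket_self hJ) scaler0 add0r (bracket_J hJ).
  by rewrite /z scalerA mulrNN divff // scale1r trmxK.
Qed.

Lemma focal_varietyE v Vb tb s :
  focal_variety J v Vb tb s =
  [set p : S | [/\ 0 < p.2, bracket J (p.1.1 - Vb) v = 0 &
                  dot (p.1.1 - Vb) v = 2 * s * Num.sqrt tb]].
Proof.
apply/seteqP; split=> p /=.
  move=> [p0 /eqP]; rewrite /isoparametric /= mulf_eq0 invr_eq0 gt_eqF //=.
  rewrite enorm_sqr paddr_eq0 ?sqr_ge0 ?dot_ge0 // sqrf_eq0 dot_eq0 subr_eq0.
  by move=> /andP[/eqP <- /eqP].
move=> [p0 b0 d]; split=> //=.
by rewrite /isoparametric b0 d subrr enorm_sqr dot0l expr0n addr0 mulr0.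
Qed.

Lemma focal_variety_slice v Vb tb s :
  focal_variety J v Vb tb s =
  affine_slice (U := @half_space R n m) (K := constraint J v)
    (constraint J v (Vb, 0, 0) + row_mx (2 * s * Num.sqrt tb)%:M 0).
Proof.
set c := row_mx _ _.
have sub p : constraint J v p = constraint J v (Vb, 0, 0) + c <->
    constraint J v (p - (Vb, 0, 0)) = c.
  have -> : constraint J v (p - (Vb, 0, 0)) =
      constraint J v p - constraint J v (Vb, 0, 0).
    by rewrite addrC -scaleN1r constraint_linear scaleN1r addrC.
  by split=> [->|<-]; [rewrite addrC addKr|rewrite addrC subrK].
rewrite focal_varietyE; apply/seteqP; split=> p /=.
  by move=> [p0 b0 d]; split=> //; apply/sub/constraint_eqP.
by move=> [p0 /sub/constraint_eqP[d b0]]; split.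
Qed.

End Model.

Theorem theorem10p3 (R : realType) (n m : nat)
    (J : {linear 'cV[R]_m -> 'M[R]_n}) (hJ : clifford_representation J)
    (v Vb : 'cV[R]_n) (tb s : R)
    (v_neq0 : v != 0) (v_le1 : enorm v <= 1) (tb_gt0 : 0 < tb)
    (hs : s = Num.sqrt (1 - enorm v ^+ 2) \/ s = - Num.sqrt (1 - enorm v ^+ 2)) :
  focal_variety J v Vb tb s =
    [set p : ambient R n m | [/\ 0 < p.2, bracket J (p.1.1 - Vb) v = 0 &
                               dot (p.1.1 - Vb) v = 2 * s * Num.sqrt tb]] /\
  (totally_geodesic (half_space (R := R) (n := n) (m := m)) (metric J)
     (focal_variety J v Vb tb s)
   <-> J2_condition J v).
Proof.
split; first exact: focal_varietyE.
rewrite focal_variety_slice.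
have linK := constraint_linear (J := J) v.
have contK := ambient_linear_continuous _ linK.
have surjK := constraint_surjective hJ v v_neq0.
set c := _ + _; have [q0 Kq0] := surjK c.
rewrite (totally_geodesic_affine_slice half_space_open linK contK c
  (fun p y => metric_linear p y) (fun p x y => metric_symmetric p x y)
  (fun p x => metric_definite p x) _ (levi_civita_christoffel hJ) surjK).
rewrite (J2_horizontalP hJ) //; split=> [KG Z U hU|inv p [p0 Kp] x y].
  have hU2 : constraint J v (U, 0, 0) = 0 by apply/constraint_eq0P.
  have hZ2 : constraint J v (0, Z, 0) = 0.
    apply/constraint_eq0P; split=> /=; [exact: dot0l|exact: bracket0l].
  (* At a point of height 1, the Christoffel map sends the pair (U, Z) to a
     vector with v-component - 2^-1 J_Z U. *)
  pose q : ambient R n m := (q0.1.1, 0, 1).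
  have Fq : affine_slice (U := @half_space R n m) (K := constraint J v) c q.
    by split; [exact: ltr01|rewrite -Kq0].
  have /constraint_eq0P := KG q Fq _ _ hU2 hZ2.
  rewrite /= mulmx0 !scale0r !add0r addr0 /central /= bracket0r scaler0 subr0.
  move=> /(horizontalZ (- 2)); rewrite scalerA invr1 mulr1 mulrNN divff //.
  by rewrite scale1r.
move=> /constraint_eq0P hx /constraint_eq0P hy; apply/constraint_eq0P.
apply: horizontalZ; apply: horizontalD; last exact: inv.
apply: horizontalD; last exact: inv.
by apply: horizontalD; exact: horizontalZ.
Qed.
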